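(* Let $k\geq 2$ be an integer, let $G$ be a $k$-connected $\Delta$-regular graph with $n$ vertices, and let $H$ be a proper subgraph of $G$. Then $$2\Delta-q(H) > \frac{2(k-1)^{2}}{2(n-\Delta)(n-\Delta+2k-4)+(n+1)(k-1)^{2}}.$$
   Context: All graphs are finite, undirected and simple. For a graph $H$, let $A(H)$ be its adjacency matrix and $D(H)$ the diagonal matrix of its vertex degrees. The signless Laplacian matrix of $H$ is $Q(H)=D(H)+A(H)$, and $q(H)$ denotes the largest eigenvalue of $Q(H)$ (the signless Laplacian spectral radius). The (vertex) connectivity $\kappa(G)$ of $G$ is the minimum number of vertices whose removal disconnects $G$ or reduces it to a single vertex; $G$ is $k$-connected if $\kappa(G)\geq k$. A proper subgraph of $G$ is a subgraph (with at least one vertex) different from $G$. *)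

(* Defs.v *)
From mathcomp Require Import all_boot all_order all_algebra.
From mathcomp Require Import boolp classical_sets reals.

Set Implicit Arguments.
Unset Strict Implicit.
Unset Printing Implicit Defensive.

Import Order.TTheory GRing.Theory Num.Theory.
Local Open Scope ring_scope.

(* Vertex sets are subsets of an ambient finite type [T], so that a graph, its
   subgraphs and its vertex-deleted subgraphs all live in [sgraph T]. *)
Record sgraph (T : finType) := SGraph {
  verts : {set T};
  adj : rel T;
  adj_sym : symmetric adj;
  adj_irrefl : irreflexive adj;
  adj_verts : forall x y, adj x y -> x \in verts
}.

Section Graphs.
Variable T : finType.
Implicit Types (G H : sgraph T) (S : {set T}).

Definition degree G (x : T) : nat := #|[pred y | adj G x y]|.

Definition regular (d : nat) G : Prop := {in verts G, forall x, degree G x = d}.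

Definition subgraph H G : Prop :=
  verts H \subset verts G /\ (forall x y, adj H x y -> adj G x y).

Definition same_graph H G : Prop := verts H = verts G /\ adj H =2 adj G.

Definition proper_subgraph H G : Prop :=
  [/\ (0 < #|verts H|)%N, subgraph H G & ~ same_graph H G].

Definition del_adj G S : rel T :=
  fun x y => [&& x \notin S, y \notin S & adj G x y].

Lemma del_adj_sym G S : symmetric (del_adj G S).
Proof. by move=> x y; rewrite /del_adj adj_sym andbCA. Qed.

Lemma del_adj_irrefl G S : irreflexive (del_adj G S).
Proof. by move=> x; rewrite /del_adj adj_irrefl !andbF. Qed.

Lemma del_adj_verts G S x y : del_adj G S x y -> x \in verts G :\: S.
Proof. by case/and3P=> xS _ /adj_verts xG; rewrite inE xS. Qed.

Definition del_verts G S : sgraph T :=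
  SGraph (@del_adj_sym G S) (@del_adj_irrefl G S) (@del_adj_verts G S).

Definition connected G : bool :=
  [forall x in verts G, forall y in verts G, connect (adj G) x y].

Definition vertex_cut G S : bool :=
  (S \subset verts G) &&
  (~~ connected (del_verts G S) || (#|verts (del_verts G S)| == 1)).

(* The default value [#|verts G|] is never the minimum when [G] has a vertex:
   deleting all vertices but one is always allowed. *)
Definition connectivity G : nat :=
  \big[minn/#|verts G|]_(S : {set T} | vertex_cut G S) #|S|.

Definition k_connected (k : nat) G : Prop := (k <= connectivity G)%N.

Section Spectrum.
Variable R : realType.

Definition adjacency_mx G : 'M[R]_#|verts G| :=
  \matrix_(i, j) (adj G (enum_val i) (enum_val j))%:R.

Definition degree_mx G : 'M[R]_#|verts G| :=
  diag_mx (\row_i (degree G (enum_val i))%:R).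

Definition signless_laplacian G : 'M[R]_#|verts G| :=
  degree_mx G + adjacency_mx G.

(* When [G] has a vertex, the real symmetric matrix [signless_laplacian G] has a
   nonempty finite set of real eigenvalues, so the supremum is a maximum. *)
Definition signless_radius G : R :=
  sup [set a : R | eigenvalue (signless_laplacian G) a]%classic.

End Spectrum.
End Graphs.

(* Main.v *)
Require Import Defs.
From mathcomp Require Import all_boot all_order all_algebra.
From mathcomp Require Import reals ring lra zify.
From mathcomp Require boolp classical_sets.

(** Since [H] is a proper subgraph and [G] has no isolated vertex, [H] lies in
    [G - uv] for some edge [uv] of [G]. Let [f] be the absolute value of an
    eigenvector of the signless Laplacian of [H] with eigenvalue [a], extended by
    zero to [G]. Comparing quadratic forms,
    [(2 Delta - a) |f|^2 >= E], where
    [E = sum over edges xy of G - uv of (f x - f y)^2 + 2 (f u)^2 + 2 (f v)^2]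
    ([eigenvalue_form], [form_le_deficit]). So it suffices to bound [|f|^2] by a
    constant times [E] ([weight_le_deficit]).

    The neighbours of [u] are controlled by the edges at [u] ([neighbour_weight]),
    and [v] by [2 (f v)^2]. For the other [n - Delta - 1] vertices [w] one uses that
    [u] and [w] cannot be separated in [G - uv] by fewer than [m = k - 1] vertices:
    this forces [m^2 (f w - f u)^2 <= M * energy] with [M = n - Delta + 2k - 4]
    ([energy_across]), hence [(f w)^2 <= (M / m^2 + 1/2) E] ([far_vertex_weight]).
    The inequality with energy is usually drawn from [m] disjoint paths given by
    Menger's theorem. Here it comes directly from the separators formed by the level
    sets of [f]: every level between [f u] and [f w] is crossed by at least [m]
    edges of a family of [M] edges, and [interval_cover] and the Cauchy-Schwarz
    inequality conclude.

    Altogether [|f|^2 <= C E] with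
    [C = (n - Delta - 1) M / m^2 + (n + 1) / 2], so every eigenvalue of [H], and
    hence their supremum, is at most [2 Delta - 1 / C]. The bound to be proved is
    [1 / (C + M / m^2)], which is strictly smaller than [1 / C]. *)

Set Implicit Arguments.
Unset Strict Implicit.
Unset Printing Implicit Defensive.

Import Order.TTheory GRing.Theory Num.Theory.
Local Open Scope ring_scope.

(** * Intervals covering every level *)

Lemma lowest_subset (R : realFieldType) (T : finType) (f : T -> R)
    (A : {set T}) (m : nat) :
  (m <= #|A|)%N ->
  exists Z : {set T}, [/\ Z \subset A, #|Z| = m &
    forall z z', z \in Z -> z' \in A :\: Z -> f z <= f z'].
Proof.
elim: m => [|m IHm] le_mA.
  by exists set0; split; rewrite ?sub0set ?cards0 // => z z'; rewrite inE.
have [Z [ZA cardZ Zlow]] := IHm (ltnW le_mA).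
have /card_gt0P [z0 z0A] : (0 < #|A :\: Z|)%N.
  by rewrite cardsD (setIidPr ZA) cardZ subn_gt0.
case: (@arg_minP _ _ _ z0 (fun z => z \in A :\: Z) f z0A) => z1 z1A z1min.
have [z1Z z1inA] : z1 \notin Z /\ z1 \in A by apply/andP; move: z1A; rewrite inE.
exists (z1 |: Z)%SET; split.
- by apply/subsetP => z /setU1P[-> //|]; apply: (subsetP ZA).
- by rewrite cardsU1 z1Z cardZ.
move=> z z' zZ; rewrite !inE negb_or -andbA => /and3P[z'z1 z'Z z'A].
have z'AZ : z' \in A :\: Z by rewrite inE z'Z.
by case/setU1P: zZ => [->|zZ]; [apply: z1min | apply: Zlow].
Qed.

Definition clamp (R : realFieldType) (p q x : R) : R := Num.max p (Num.min x q).

(** Cutting the levels between [p] and [q] at [r] cuts the image of each interval too. This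
    is what lets [clamp_cover] do without an integral over the levels. *)
Lemma clamp_split (R : realFieldType) (p r q x : R) :
  p <= r -> r <= q -> clamp p q x = clamp p r x + clamp r q x - r.
Proof.
move=> pr rq; have pq := le_trans pr rq; rewrite /clamp.
have [xr|rx] := leP x r.
  rewrite (min_idPl (le_trans xr rq)) (max_idPl xr); lra.
rewrite (max_idPr (_ : p <= r)) // (max_idPr (_ : r <= _)) ?le_min ?(ltW rx) //.
rewrite (max_idPr _) ?le_min ?(le_trans pr (ltW rx)) ?pq //; lra.
Qed.

Lemma clamp_homo (R : realFieldType) (p q : R) :
  {homo clamp p q : a b / a <= b}.
Proof. by move=> a b ab; rewrite le_max2 // le_min2. Qed.

Lemma clamp_lipschitz (R : realFieldType) (p q a b : R) :
  a <= b -> clamp p q b - clamp p q a <= b - a.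
Proof.
move=> ab; rewrite lerBlDl ge_max; apply/andP; split.
  have : p <= clamp p q a by rewrite le_max lexx.
  lra.
have : Num.min a q <= clamp p q a by rewrite le_max lexx orbT.
have [aq|qa] := leP a q; last first.
  by have : Num.min b q <= q; [rewrite ge_min lexx orbT | lra].
have : Num.min b q <= b by rewrite ge_min lexx.
lra.
Qed.

(** Induction on the number of endpoints lying strictly between [p] and [q]: an
    endpoint [r] in between splits the claim at [r]. With none in between, an
    interval that contains [p] reaches up to [q], and [m] of them contain [p]. *)
Lemma clamp_cover (R : realFieldType) (I : finType) (P : {set I})
    (a b : I -> R) (m : nat) (p q : R) :
  p <= q -> (forall e, e \in P -> a e <= b e) ->
  (forall t, p <= t -> t < q ->
     (m <= #|[set e in P | (a e <= t)%R && (t < b e)%R]%SET|)%N) ->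
  m%:R * (q - p) <= \sum_(e in P) (clamp p q (b e) - clamp p q (a e)).
Proof.
move=> pq ab; move: p q pq.
pose L := [seq a e | e : I] ++ [seq b e | e : I].
pose inner p q := count (fun x => (p < x) && (x < q)) L.
move=> p q; have [N] := ubnP (inner p q); elim: N p q => // N IHN p q.
rewrite ltnS => innerN pq cov.
have [/hasP [r rL /andP[pr rq]]|/hasPn noL] :=
  boolP (has (fun x => (p < x) && (x < q)) L).
  have split_inner p' q' : p <= p' -> q' <= q -> ~~ ((p' < r) && (r < q')) ->
      (inner p' q' < N)%N.
    move=> pp' qq' r_out; apply: leq_trans innerN; rewrite /inner.
    (* [r] itself is an endpoint counted on [(p, q)] and no longer on [(p', q')]. *)
    have le1 : (count (fun x => (p' < x) && (x < q'))%R L + count_mem r L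
        <= count (fun x => (p < x) && (x < q))%R L)%N.
      rewrite -count_predUI.
      rewrite [X in (_ + X)%N](@eq_count _ _ pred0) ?count_pred0 ?addn0.
        apply: sub_count => x /orP[/andP[? ?]|/eqP -> /=]; last by rewrite pr rq.
        by apply/andP; split; lra.
      move=> x /=; case: (eqVneq x r) => [->|]; last by rewrite andbF.
      by rewrite andbT; apply: negbTE.
    apply: leq_trans le1; rewrite -addn1 leq_add2l -has_count.
    by apply/hasP; exists r => //=.
  rewrite (eq_bigr (fun e => (clamp p r (b e) - clamp p r (a e))
                             + (clamp r q (b e) - clamp r q (a e)))); last first.
    by move=> e _; rewrite !(@clamp_split _ p r q) ?ltW //; lra.
  rewrite big_split /= (_ : _ * _ = m%:R * (r - p) + m%:R * (q - r)); last ring.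
  apply: lerD; apply: IHN; rewrite ?(ltW pr) ?(ltW rq) //.
  - by apply: split_inner; rewrite ?ltxx ?andbF ?(ltW rq).
  - by move=> t pt tr; apply: cov => //; lra.
  - by apply: split_inner; rewrite ?ltxx ?(ltW pr).
  - by move=> t pt tr; apply: cov => //; lra.
move: pq; rewrite le_eqVlt => /predU1P[<-|pq].
  by rewrite subrr mulr0; apply: sumr_ge0 => e eP; rewrite subr_ge0 clamp_homo ?ab.
have := cov p (lexx _) pq; rewrite -(ler_nat R) => cov_p.
apply: le_trans (_ : #|[set e in P | (a e <= p)%R && (p < b e)%R]%SET|%:R * (q - p) <= _).
  by apply: ler_wpM2r => //; lra.
rewrite mulr_natl -sumr_const big_mkcond [leRHS]big_mkcond /=.
apply: ler_sum => e _; rewrite inE; case: ifP => // [/andP[eP /andP[ap pb]]|_];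
  last by case: ifP => // eP; rewrite subr_ge0 clamp_homo ?ab.
rewrite eP.
have qb : q <= b e.
  rewrite leNgt; apply/negP => bq.
  have bL : b e \in L by rewrite mem_cat map_f ?orbT ?mem_enum.
  by have := noL _ bL; rewrite pb bq.
rewrite /clamp (min_idPr qb) (max_idPr (ltW pq)).
by rewrite (min_idPl (ltW (le_lt_trans ap pq))) (max_idPl ap).
Qed.

(** A finite substitute for integrating the number of intervals above a level
    [t] over all [t] between [p] and [q]. *)
Lemma interval_cover (R : realFieldType) (I : finType) (P : {set I})
    (a b : I -> R) (m : nat) (p q : R) :
  p <= q -> (forall e, e \in P -> a e <= b e) ->
  (forall t, p <= t -> t < q ->
     (m <= #|[set e in P | (a e <= t)%R && (t < b e)%R]%SET|)%N) ->
  m%:R * (q - p) <= \sum_(e in P) (b e - a e).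
Proof.
move=> pq ab cov; apply: le_trans (clamp_cover pq ab cov) _.
by apply: ler_sum => e eP; apply: clamp_lipschitz; apply: ab.
Qed.

Lemma sqr_sum_le (R : realFieldType) (I : finType) (P : {set I}) (d : I -> R) :
  (\sum_(e in P) d e) ^+ 2 <= #|P|%:R * \sum_(e in P) d e ^+ 2.
Proof.
move sE: (\sum_(e in P) d e) => s; pose N : R := #|P|%:R.
have [N0|N0] := eqVneq #|P| 0%N.
  by rewrite -sE N0 mul0r (cards0_eq N0) big_set0 expr0n.
have Npos : 0 < N by rewrite ltr0n lt0n.
have : 0 <= \sum_(e in P) (N * d e - s) ^+ 2.
  by apply: sumr_ge0 => e _; apply: sqr_ge0.
have -> : \sum_(e in P) (N * d e - s) ^+ 2
   = N * (N * \sum_(e in P) d e ^+ 2 - s ^+ 2).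
  transitivity (N ^+ 2 * (\sum_(e in P) d e ^+ 2)
     - 2 * N * s * (\sum_(e in P) d e) + \sum_(e in P) s ^+ 2).
    rewrite !mulr_sumr -sumrB -big_split /=; apply: eq_bigr => e _; ring.
  rewrite sumr_const sE -mulr_natl -/N; ring.
by rewrite pmulr_rge0 // subr_ge0.
Qed.

(** * Dirichlet energy and vertex separators *)

Section Energy.
Variables (R : realFieldType) (T : finType) (h : rel T).
Hypothesis h_sym : symmetric h.

(** Each edge is charged to its lower end, so that the energies of edges chosen
    at distinct lower ends add up without repetition. *)
Definition rise (f : T -> R) (x : T) : R :=
  \sum_(y | h x y && (f x < f y)) (f y - f x) ^+ 2.

Definition energy (f : T -> R) : R := \sum_x rise f x.

Lemma rise_ge0 f x : 0 <= rise f x.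
Proof. by apply: sumr_ge0 => y _; apply: sqr_ge0. Qed.

Lemma rise_le_energy f x : rise f x <= energy f.
Proof.
by rewrite /energy (bigD1 x) //= lerDl; apply: sumr_ge0 => y _; apply: rise_ge0.
Qed.

(** An edge contributes [f x (f x - f y) + f y (f y - f x) = (f x - f y)^2], once
    its two orientations are taken together. *)
Lemma energyE f : \sum_x \sum_(y | h x y) (f x ^+ 2 - f x * f y) = energy f.
Proof.
pose F x y := f x ^+ 2 - f x * f y.
transitivity (\sum_x (\sum_(y | h x y && (f x < f y)) F x y
            + \sum_(y | h x y && (f y < f x)) F x y)).
  apply: eq_bigr => x _; rewrite (bigID (fun y => f x < f y)) /=; congr (_ + _).
  rewrite (bigID (fun y => f y < f x)) /= [X in _ + X]big1 ?addr0.
    by apply: eq_bigl => y; case: (h x y) => //=; case: ltgtP.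
  move=> y /andP[/andP[_ ]]; case: ltgtP => // fxy _ _; rewrite fxy; ring.
rewrite big_split /=.
rewrite [X in _ + X](exchange_big_dep xpredT) //= -big_split /=.
apply: eq_bigr => x _; rewrite /rise.
rewrite [X in _ + X](eq_bigl (fun y => h x y && (f x < f y))); last first.
  by move=> y; rewrite h_sym.
by rewrite -big_split /=; apply: eq_bigr => y _; rewrite /F; ring.
Qed.

Definition separates (A S : {set T}) : Prop :=
  forall x y, x \in A -> y \notin A -> h x y -> (x \in S) || (y \in S).

Definition nbrs (x : T) : {set T} := [set y | h x y]%SET.

(** Write [M] for the factor of the energy. With [m] internally disjoint paths from
    [u] to [w], of total length at most [M], the bound would follow from the
    Cauchy-Schwarz inequality on the edges of the paths. The paths can be avoided:
    at each level [t] between [f u] and [f w], taking one end of each edge that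
    crosses [t] gives a separator of [u] and [w], hence at least [m] vertices; so
    the edges chosen at these vertices rise by at least [m (f w - f u)] in total.
    It remains to use only [M] edges. The end taken is the lower one, with its
    steepest ascending edge, except that an edge at [u] is represented by its upper
    end; there the [m] highest neighbours [W] of [u] suffice, since a level below
    all of [W] already has [m] edges. Likewise only the [m] lowest neighbours [Z] of
    [w] are used: either all of [Z] is below the level, which gives [m] edges to
    [w], or some vertex of [Z] is above it, and then so are the neighbours of [w]
    outside [Z]. This saves [deg w - m] edges. *)
Lemma energy_across (V : {set T}) (u w : T) (m : nat) (f : T -> R) :
  (forall x y, h x y -> x \in V) -> u \in V -> w \in V -> u != w ->
  ~~ h u w -> ~~ h w w -> ~~ h u u ->
  (forall A S : {set T}, u \in A -> w \notin A -> u \notin S -> w \notin S ->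
     separates A S -> (m <= #|S|)%N) ->
  f u <= f w ->
  (m%:R * (f w - f u)) ^+ 2
    <= (#|V|%:R - 2 - #|nbrs w|%:R + 2 * m%:R) * energy f.
Proof.
move=> hV uV wV uw huw hww huu sep fuw.
have hwu : ~~ h w u by rewrite h_sym.
have m_w : (m <= #|nbrs w|)%N.
  apply: (sep (~: [set w])%SET); rewrite ?inE ?eqxx //.
  by move=> x y _; rewrite !inE negbK => /eqP -> hxw; rewrite h_sym hxw.
have m_u : (m <= #|nbrs u|)%N.
  apply: (sep [set u]%SET); rewrite ?inE ?eqxx // 1?eq_sym //.
  by move=> x y; rewrite !inE => /eqP -> _ ->; rewrite orbT.
have [Z [ZN cardZ Zlow]] := lowest_subset f m_w.
have [W [WN cardW Whigh]] := lowest_subset (fun x => - f x) m_u.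
pose Y := ((V :\: [set u; w]) :\: (nbrs w :\: Z))%SET.
have up_ex y : {z : T | ((z == y) || h y z) /\
    (forall z', h y z' -> f z' <= f z) /\ f y <= f z}.
  case: (@arg_maxP _ _ _ y (fun z => (z == y) || h y z) f); rewrite ?eqxx // => z Pz zmax.
  exists z; split=> //; split=> [z' hz'|]; apply: zmax; rewrite ?hz' ?eqxx ?orbT //.
pose up y := sval (up_ex y).
have up_nbr y : (up y == y) || h y (up y) by case: (svalP (up_ex y)).
have up_max y z : h y z -> f z <= f (up y).
  by case: (svalP (up_ex y)) => _ [H _]; apply: H.
have up_ge y : f y <= f (up y) by case: (svalP (up_ex y)) => _ [_ H].
have wW : w \notin W by apply: contraNN huw => /(subsetP WN); rewrite inE.
have uW : u \notin W by apply: contraNN huu => /(subsetP WN); rewrite inE.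
have uY : u \notin Y by rewrite !inE eqxx /= ?andbF.
have wY : w \notin Y by rewrite !inE eqxx ?orbT /= ?andbF.
have ZY : Z \subset Y.
  apply/subsetP => z zZ; have := subsetP ZN z zZ; rewrite !inE zZ /= => hwz.
  rewrite (hV z w) 1?h_sym // andbT negb_or.
  by apply/andP; split; apply: contraTneq hwz => ->.
have cardY : (#|Y| + 2 + #|nbrs w| = #|V| + m)%N.
  have uwV : [set u; w]%SET \subset V.
    by apply/subsetP => x /set2P[]->.
  have NV : (nbrs w :\: Z)%SET \subset (V :\: [set u; w])%SET.
    apply/subsetP => z; rewrite !inE => /andP[_ hwz].
    rewrite (hV z w) 1?h_sym // andbT negb_or.
    by apply/andP; split; apply: contraTneq hwz => ->.
  have := subset_leq_card NV; have := subset_leq_card uwV.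
  rewrite /Y !cardsD (setIidPr NV) (setIidPr uwV) (setIidPr ZN) cards2 uw cardZ /= => le2 leN.
  rewrite cardsD (setIidPr ZN) cardZ.
  by move: #|V| #|nbrs w| m_w le2 leN; clear; lia.
have memY x : x \in V -> x != u -> x != w -> (h w x -> x \in Z) -> x \in Y.
  move=> xV xu xw xZ; rewrite !inE xV negb_or xu xw !andbT negb_and negbK.
  by rewrite orbC -implybE; apply/implyP.
move: Y uY wY ZY cardY memY => Y uY wY ZY cardY memY.
(* [inl y] stands for the steepest edge at [y], [inr z] for the edge from [u] to
   [z]; the maximum makes the interval empty when that edge does not ascend. *)
pose P : {set T + T} := [set e | match e with inl y => y \in Y | inr z => z \in W end]%SET.
pose lo (e : T + T) := match e with inl y => f y | inr _ => f u end.
pose hi (e : T + T) :=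
  match e with inl y => f (up y) | inr z => Num.max (f u) (f z) end.
have sumP (F : T + T -> R) :
    \sum_(e in P) F e = \sum_(y in Y) F (inl y) + \sum_(z in W) F (inr z).
  by rewrite big_sumType /=; congr (_ + _); apply: eq_bigl => x; rewrite inE.
have cardP : (#|P|%:R : R) = #|V|%:R - 2 - #|nbrs w|%:R + 2 * m%:R.
  have -> : (#|P|%:R : R) = (#|Y| + #|W|)%:R.
    by rewrite -sumr_const sumP !sumr_const natrD.
  have /(congr1 (fun x => x%:R : R)) := cardY.
  by rewrite cardW !natrD; lra.
have lohi e : e \in P -> lo e <= hi e.
  by case: e => x _ /=; rewrite ?le_max ?lexx.
have cover t : f u <= t -> t < f w ->
    (m <= #|[set e in P | (lo e <= t)%R && (t < hi e)%R]%SET|)%N.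
  move=> ut tw.
  pose S1 := [set y in Y | (f y <= t) && (t < f (up y))]%SET.
  pose S2 := [set z in W | t < f z]%SET.
  have -> : #|[set e in P | (lo e <= t)%R && (t < hi e)%R]%SET| = (#|S1| + #|S2|)%N.
    rewrite -!sum1_card big_sumType /=; congr (_ + _)%N; apply: eq_bigl => x;
      rewrite !inE //= ut /= lt_max; case: (x \in W) => //=.
    by rewrite ltNge ut.
  (* Either all of [W] is above [t], or all of [Z] is below it, or the vertices
     of [S1] and [S2] separate [u] from [w]. *)
  have [WS|] := boolP (W \subset S2).
    by rewrite -cardW (leq_trans (subset_leq_card WS)) ?leq_addl.
  case/subsetPn => w1 w1W; rewrite inE w1W /= -leNgt => w1t.
  have [ZS|] := boolP (Z \subset S1).
    by rewrite -cardZ (leq_trans (subset_leq_card ZS)) ?leq_addr.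
  case/subsetPn => z1 z1Z; rewrite inE (subsetP ZY _ z1Z) /= => z1t.
  have {}z1t : t < f z1.
    rewrite ltNge; apply: contra z1t => -> /=; apply: lt_le_trans tw _.
    by apply: up_max; have := subsetP ZN _ z1Z; rewrite inE h_sym.
  have <- : #|S1 :|: S2| = (#|S1| + #|S2|)%N.
    rewrite cardsU [S1 :&: S2](_ : _ = set0) ?cards0 ?subn0 //.
    apply/setP => x; rewrite !inE.
    by case: (leP (f x) t) => _; rewrite ?andbF.
  apply: (sep [set x | f x <= t]%SET); rewrite ?inE //.
  - by rewrite -ltNge.
  - by rewrite (negbTE uY) (negbTE uW).
  - by rewrite (negbTE wY) (negbTE wW).
  move=> x y; rewrite !inE -ltNge => xt ty hxy.
  rewrite -!orbA; have [xu|xu] := eqVneq x u.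
    suff -> : y \in W by rewrite ty !orbT.
    apply/negPn/negP => yW; rewrite xu in hxy.
    have /(Whigh _ _ w1W) : y \in nbrs u :\: W by rewrite !inE yW.
    by rewrite lerN2; lra.
  rewrite xt (lt_le_trans ty (up_max _ _ hxy)) !andbT.
  suff -> : x \in Y by [].
  apply: memY => //; first exact: hV hxy.
    by apply: contraTneq xt => ->; rewrite -ltNge.
  move=> hwx; apply/negPn/negP => xZ.
  have /(Zlow _ _ z1Z) : x \in nbrs w :\: Z by rewrite !inE xZ.
  lra.
have main := interval_cover fuw lohi cover.
have energy_ge : \sum_(e in P) (hi e - lo e) ^+ 2 <= energy f.
  rewrite sumP /energy [leRHS](bigID (mem Y)) /=; apply: lerD.
    apply: ler_sum => y _; rewrite /rise.
    have := up_ge y; rewrite le_eqVlt => /predU1P[->|ylt].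
      by rewrite subrr expr0n /=; apply: sumr_ge0 => z _; apply: sqr_ge0.
    rewrite (bigD1 (up y)) /= ?lerDl; first by apply: sumr_ge0 => *; apply: sqr_ge0.
    by have := up_nbr y; rewrite ylt andbT; case: eqP => // E; rewrite E ltxx in ylt.
  rewrite [leRHS](bigD1 u) //=; apply: ler_wpDr; first by apply: sumr_ge0 => *; apply: rise_ge0.
  rewrite /rise big_mkcond [leRHS]big_mkcond /=; apply: ler_sum => z _.
  case: ifP => [/(subsetP WN)|_]; last by case: ifP => // _; apply: sqr_ge0.
  rewrite inE => ->; rewrite /=; case: ltP => _ //; by rewrite subrr expr0n.
rewrite -cardP; apply: le_trans (_ : _ <= #|P|%:R * \sum_(e in P) (hi e - lo e) ^+ 2) _.
  apply: le_trans (sqr_sum_le _ _); rewrite ler_sqr ?nnegrE //.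
    by rewrite mulr_ge0 // subr_ge0.
  by apply: sumr_ge0 => e eP; rewrite subr_ge0 lohi.
by apply: ler_wpM2l.
Qed.
End Energy.

(** * Connectivity and separators *)

Section Connectivity.
Variables (T : finType) (G : sgraph T).

Lemma degreeE (x : T) : degree G x = #|nbrs (adj G) x|.
Proof. by rewrite /degree cardsE. Qed.

Lemma connectivity_le_cut (S : {set T}) :
  vertex_cut G S -> (connectivity G <= #|S|)%N.
Proof.
by move=> cutS; rewrite /connectivity -minEnat -leEnat; apply: bigmin_le_cond.
Qed.

Lemma vertex_cut_separates (A S : {set T}) (u w : T) :
  S \subset verts G -> u \in verts G -> w \in verts G ->
  u \in A -> w \notin A -> u \notin S -> w \notin S ->
  separates (adj G) A S -> vertex_cut G S.
Proof.
move=> SV uV wV uA wA uS wS sep; rewrite /vertex_cut SV /=; apply/orP; left.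
apply/negP => /forallP/(_ u)/implyP; rewrite inE uS uV => /(_ isT).
move=> /forallP/(_ w)/implyP; rewrite inE wS wV => /(_ isT) uw.
have A_closed : fingraph.closed (adj (del_verts G S)) A.
  apply: intro_closed => [|x y].
    by apply: sym_connect_sym => x y; apply: del_adj_sym.
  rewrite /= => /and3P[xS yS xy] xA; apply/negPn/negP => yA.
  by have := sep _ _ xA yA xy; rewrite (negbTE xS) (negbTE yS).
by have := closed_connect A_closed uw; rewrite uA (negbTE wA).
Qed.

(** Deleting the neighbours of [x] isolates [x], or leaves [x] alone: both count as
    vertex cuts. *)
Lemma connectivity_le_degree (x : T) :
  x \in verts G -> (connectivity G <= degree G x)%N.
Proof.
move=> xV; pose N := nbrs (adj G) x.
rewrite degreeE -/N.
have xN : x \notin N by rewrite inE adj_irrefl.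
have NV : N \subset verts G.
  by apply/subsetP => y; rewrite inE adj_sym => /adj_verts.
apply: connectivity_le_cut.
have [V1|/set0Pn[y]] := eqVneq (verts G :\: N :\ x) set0.
  rewrite /vertex_cut NV /= (_ : verts G :\: N = [set x])%SET ?cards1 ?orbT //.
  by apply/eqP; rewrite eqEsubset sub1set inE xN xV -setD_eq0 V1 eqxx.
rewrite !inE => /and3P[yx yN yV].
apply: (@vertex_cut_separates [set x] _ x y) => //; rewrite ?inE ?eqxx //.
by move=> a b /set1P-> _ ab; rewrite !inE ab orbT.
Qed.

Lemma adj_neq (x y : T) : adj G x y -> x != y.
Proof. by apply: contraTneq => ->; rewrite adj_irrefl. Qed.

Lemma degree_lt_card (x : T) : x \in verts G -> (degree G x < #|verts G|)%N.
Proof.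
move=> xV; rewrite (cardsD1 x) xV ltnS; apply: subset_leq_card.
apply/subsetP => y; rewrite !inE => xy.
by rewrite (adj_verts (y := x)) 1?adj_sym // andbT eq_sym (adj_neq xy).
Qed.

End Connectivity.

Definition del_edge (T : finType) (e : rel T) (u v : T) : rel T :=
  fun x y => [&& e x y, ~~ ((x == u) && (y == v)) & ~~ ((x == v) && (y == u))].

Section EdgeDeletion.
Variables (T : finType) (G : sgraph T) (u v : T).
Hypothesis uv : adj G u v.
Let h := del_edge (adj G) u v.

Lemma del_edge_sym : symmetric h.
Proof.
move=> x y; rewrite /h /del_edge adj_sym; congr (_ && _).
by rewrite andbC ![(y == _) && _]andbC.
Qed.

Lemma del_edge_verts x y : h x y -> x \in verts G.
Proof. by case/and3P => /adj_verts. Qed.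

Lemma card_nbrs_del_edge_end : (#|nbrs h u|.+1 = degree G u)%N.
Proof.
rewrite degreeE [RHS](cardsD1 v) inE uv; congr _.+1; apply: eq_card => y.
rewrite !inE /h /del_edge eqxx (negbTE (adj_neq uv)) /=.
by case: (adj G u y); case: (y == v).
Qed.

Lemma card_nbrs_del_edge x : x != u -> x != v -> #|nbrs h x| = degree G x.
Proof.
move=> xu xv; rewrite degreeE; apply: eq_card => y.
by rewrite !inE /h /del_edge (negbTE xu) (negbTE xv) /= andbT.
Qed.

(** A separator of the graph without the edge [uv] becomes one of [G] when [v] is
    added to it, so deleting an edge costs at most one in local connectivity. *)
Lemma connectivity_del_edge (w : T) (A S : {set T}) :
  w \in verts G -> w != v -> u \in A -> w \notin A ->
  u \notin S -> w \notin S -> separates h A S ->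
  (connectivity G <= #|S|.+1)%N.
Proof.
move=> wV wv uA wA uS wS sep.
have uV : u \in verts G := adj_verts uv.
have vV : v \in verts G by apply: (@adj_verts _ _ _ u); rewrite adj_sym.
apply: (@leq_trans #|(v |: S) :&: verts G|); last first.
  apply: leq_trans (subset_leq_card (subsetIl _ _)) _.
  by rewrite cardsU1; case: (v \notin S).
apply: connectivity_le_cut.
apply: (@vertex_cut_separates _ _ A _ u w) => //; rewrite ?subsetIr //.
- by rewrite !inE (negbTE (adj_neq uv)) (negbTE uS).
- by rewrite !inE (negbTE wv) (negbTE wS).
move=> x y xA yA xy; rewrite !inE (adj_verts xy).
have -> : y \in verts G by apply: (@adj_verts _ _ _ x); rewrite adj_sym.
rewrite !andbT; have [hxy|] := boolP (h x y).
  by have /orP[->|->] := sep _ _ xA yA hxy; rewrite ?orbT.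
rewrite /h /del_edge xy /= negb_and !negbK.
by case/orP => /andP[/eqP-> /eqP->]; rewrite eqxx ?orbT.
Qed.

End EdgeDeletion.

(** * Bounding the total weight *)

(** [E] is the deficit [2 Delta |f|^2 - f Q f] of the quadratic form of the signless
    Laplacian of [G - uv]; [M] bounds the number of edges used in [energy_across]
    with [m = k - 1] and a far end of degree [Delta]. *)
Section WeightBound.
Variables (R : realFieldType) (T : finType) (G : sgraph T) (u v : T).
Variables (k Delta : nat) (f : T -> R).
Hypotheses (k_ge2 : (2 <= k)%N) (G_kconn : k_connected k G)
  (G_reg : regular Delta G) (uv : adj G u v).
Hypotheses (f_ge0 : forall x, 0 <= f x)
  (f_out : forall x, x \notin verts G -> f x = 0).
Let h := del_edge (adj G) u v.
Let n : R := #|verts G|%:R.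
Let d : R := Delta%:R.
Let m : R := k%:R - 1.
Let M : R := n - d + 2 * k%:R - 4.
Let E : R := energy h f + 2 * f u ^+ 2 + 2 * f v ^+ 2.

Let hS : symmetric h := del_edge_sym G u v.

Let uV : u \in verts G := adj_verts uv.

Let vV : v \in verts G.
Proof. by apply: (@adj_verts _ _ _ u); rewrite adj_sym. Qed.

Let k_le_Delta : (k <= Delta)%N.
Proof.
by apply: leq_trans G_kconn _; rewrite -(G_reg uV) connectivity_le_degree.
Qed.

Let Delta_lt_n : (Delta < #|verts G|)%N.
Proof. by rewrite -(G_reg uV) degree_lt_card. Qed.

Let m_ge1 : 1 <= m.
Proof. by have := k_ge2; rewrite -(ler_nat R) /m => ?; lra. Qed.

Let nd : 1 <= n - d.
Proof.
by have := Delta_lt_n; rewrite -(ler_nat R) -addn1 natrD /n /d => ?; lra.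
Qed.

Let M_gt0 : 0 < M.
Proof. by have := nd; have := m_ge1; rewrite /m /M => *; lra. Qed.

Let energy_ge0 : 0 <= energy h f.
Proof. by apply: sumr_ge0 => x _; apply: rise_ge0. Qed.

(** If [f w <= f u], the term [2 (f u)^2] of [E] is enough. Otherwise the energy is
    at least [(f w - f u)^2 / b] with [b = M / m^2], and the minimum of
    [(f w - f u)^2 / b + 2 (f u)^2] over [f u] is [(f w)^2 / (b + 1/2)]. *)
Lemma far_vertex_weight (w : T) : w \in verts G -> w != u -> w != v -> ~~ h u w ->
  f w ^+ 2 <= (M / m ^+ 2 + 1 / 2) * E.
Proof.
move=> wV wu wv huw.
set b := M / m ^+ 2.
have m2 : 0 < m ^+ 2 by rewrite exprn_gt0 // (lt_le_trans ltr01 m_ge1).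
have b0 : 0 < b by rewrite divr_gt0.
have fu2 := sqr_ge0 (f u); have fv2 := sqr_ge0 (f v).
have [fwu|fuw] := leP (f w) (f u).
  have : f w ^+ 2 <= f u ^+ 2 by rewrite ler_sqr ?nnegrE.
  have uE : 2 * f u ^+ 2 <= E by have := energy_ge0; rewrite /E => ?; lra.
  have bE : 0 <= b * E by rewrite mulr_ge0 ?(ltW b0) //; lra.
  by rewrite mulrDl => *; lra.
have D2 : (f w - f u) ^+ 2 <= b * energy h f.
  have irr x : ~~ h x x by rewrite /h /del_edge adj_irrefl.
  have := @energy_across R T h hS (verts G) u w k.-1 f
    (@del_edge_verts _ G u v) uV wV _ huw (irr w) (irr u).
  rewrite eq_sym wu => /(_ isT).
  have sep (A S : {set T}) : u \in A -> w \notin A -> u \notin S -> w \notin S ->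
      separates h A S -> (k.-1 <= #|S|)%N.
    move=> uA wA uS wS sAS.
    have := leq_trans G_kconn (connectivity_del_edge uv wV wv uA wA uS wS sAS).
    by case: (k).
  move=> /(_ sep (ltW fuw)).
  rewrite (card_nbrs_del_edge G wu wv) (G_reg wV).
  have -> : (k.-1%:R : R) = m by rewrite -subn1 natrB // (ltnW k_ge2).
  rewrite exprMn => H.
  rewrite /b mulrAC ler_pdivlMr // mulrC; apply: le_trans H _.
  by rewrite ler_wpM2r // /M /m; lra.
pose x := f w - f u; pose y := f u.
have key : f w ^+ 2 <= (b + 1 / 2) * (b^-1 * x ^+ 2 + 2 * y ^+ 2).
  rewrite -subr_ge0.
  have -> : (b + 1 / 2) * (b^-1 * x ^+ 2 + 2 * y ^+ 2) - f w ^+ 2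
     = 2 * b * (y - x / (2 * b)) ^+ 2.
    by rewrite /x /y; field; rewrite gt_eqF.
  by rewrite mulr_ge0 ?sqr_ge0 // mulr_ge0 // ltW.
apply: le_trans key _; apply: ler_wpM2l; first by lra.
have : b^-1 * x ^+ 2 <= energy h f by rewrite ler_pdivrMl.
by rewrite /E /y; lra.
Qed.

(** The edges at [u] alone control its neighbours: with [s = (d - 1) / 2],
    [(f w)^2 <= (1 + s) (f w - f u)^2 + (1 + 1/s) (f u)^2], and there are [d - 1]
    neighbours. For [f w <= f u] the second term suffices. *)
Lemma neighbour_weight :
  \sum_(w in nbrs h u) f w ^+ 2
    <= (d + 1) / 2 * rise h f u + (d + 1) * f u ^+ 2.
Proof.
have d2 : 2 <= d by rewrite ler_nat (leq_trans k_ge2).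
have c0 : d - 1 != 0 by apply: lt0r_neq0; lra.
have cardN : (#|nbrs h u|%:R : R) = d - 1.
  by rewrite /d -(G_reg uV) -(card_nbrs_del_edge_end uv) -addn1 natrD; lra.
have -> : (d + 1) * f u ^+ 2 = \sum_(w in nbrs h u) (d + 1) / (d - 1) * f u ^+ 2.
  by rewrite sumr_const -mulr_natl cardN; field.
have -> : rise h f u
    = \sum_(w in nbrs h u) (if f u < f w then (f w - f u) ^+ 2 else 0).
  by rewrite /rise big_mkcondr; apply: eq_bigl => w; rewrite inE.
rewrite mulr_sumr -big_split /=; apply: ler_sum => w _.
have fu2 := sqr_ge0 (f u).
have c1 : 1 <= (d + 1) / (d - 1) by rewrite ler_pdivlMr; lra.
case: ltP => [_|wu].
  rewrite -subr_ge0.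
  have -> : (d + 1) / 2 * (f w - f u) ^+ 2 + (d + 1) / (d - 1) * f u ^+ 2 - f w ^+ 2
      = (d - 1) / 2 * (f w - f u - 2 * f u / (d - 1)) ^+ 2.
    by field.
  by rewrite mulr_ge0 ?sqr_ge0 //; lra.
rewrite mulr0 add0r.
apply: (@le_trans _ _ (f u ^+ 2)); first by rewrite ler_sqr ?nnegrE.
by rewrite ler_peMl.
Qed.

(** The [n - d - 1] vertices outside [u], [v] and the neighbours of [u] are bounded
    one by one by [far_vertex_weight]. For [v] the term [2 (f v)^2] of the deficit
    is enough, without any path length: this gain of one [M / m^2] is what makes
    the final inequality strict. *)
Lemma weight_le_deficit :
  \sum_x f x ^+ 2 <= ((n - d - 1) * (M / m ^+ 2) + (n + 1) / 2) * E.
Proof.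
have neq_uv := adj_neq uv.
pose far := (((verts G :\ u) :\ v) :\: nbrs h u)%SET.
have huv : ~~ h u v by rewrite /h /del_edge !eqxx /= andbF.
have huu : ~~ h u u by rewrite /h /del_edge adj_irrefl.
have NV : nbrs h u \subset (verts G :\ u) :\ v.
  apply/subsetP => y; rewrite !inE => huy.
  rewrite (@del_edge_verts _ G u v y u) -?/h 1?hS // andbT.
  by apply/andP; split; apply: contraTneq huy => ->.
have -> : \sum_x f x ^+ 2 = f u ^+ 2 + f v ^+ 2
    + \sum_(w in nbrs h u) f w ^+ 2 + \sum_(w in far) f w ^+ 2.
  transitivity (\sum_(x in verts G) f x ^+ 2).
    rewrite (bigID (mem (verts G))) /= [X in _ + X]big1 ?addr0 // => x xV.
    by rewrite f_out // expr0n.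
  rewrite (big_setD1 u) //= (big_setD1 v) /=; last by rewrite !inE eq_sym neq_uv.
  by rewrite [in LHS](big_setID (nbrs h u)) /= (setIidPr NV) !addrA.
have card_far : (#|far|%:R : R) = n - d - 1.
  have : (#|far| + Delta + 1 = #|verts G|)%N.
    have := card_nbrs_del_edge_end uv; rewrite (G_reg uV) -/h.
    have -> : #|far| = (#|verts G :\ u :\ v| - #|nbrs h u|)%N.
      by rewrite /far cardsD (setIidPr NV).
    have := subset_leq_card NV.
    have := cardsD1 v (verts G :\ u); have := cardsD1 u (verts G).
    rewrite uV !inE eq_sym neq_uv vV /=.
    by move: #|nbrs h u| #|_| #|_| #|_|; clear; lia.
  by move/(congr1 (fun i => i%:R : R)); rewrite !natrD /n /d => *; lra.
have far_le : \sum_(w in far) f w ^+ 2 <= (n - d - 1) * ((M / m ^+ 2 + 1 / 2) * E).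
  rewrite -card_far mulr_natl -sumr_const; apply: ler_sum => w.
  by rewrite !inE => /and4P[huw wv wu wV]; apply: far_vertex_weight.
have near := neighbour_weight.
have rE : rise h f u <= energy h f := rise_le_energy h f u.
have d0 : 0 <= d by rewrite ler0n.
have fv2 : 0 <= (d + 1) * f v ^+ 2 by rewrite mulr_ge0 ?sqr_ge0 ?addr_ge0.
have dE : (d + 1) / 2 * rise h f u <= (d + 1) / 2 * energy h f.
  by rewrite ler_wpM2l //; lra.
move: far_le near dE fv2 energy_ge0; rewrite /E.
move: (M / m ^+ 2) (\sum_(w in far) _) (\sum_(w in nbrs h u) _) => b s1 s2.
move: (energy h f) (rise h f u) (f u ^+ 2) (f v ^+ 2) => e r fu fv.
move=> *; lra.
Qed.

End WeightBound.

(** * From eigenvalues to the deficit *)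

Section Quadratic.
Variables (R : realType) (T : finType) (H : sgraph T).

(** Extend an eigenvector by zero; taking absolute values keeps its norm and does
    not decrease the quadratic form. *)
Lemma eigenvalue_form (a : R) : eigenvalue (signless_laplacian R H) a ->
  exists f : T -> R, [/\ forall x, 0 <= f x, forall x, x \notin verts H -> f x = 0,
    0 < \sum_x f x ^+ 2 &
    a * \sum_x f x ^+ 2 <= \sum_x \sum_(y | adj H x y) (f x ^+ 2 + f x * f y)].
Proof.
case/eigenvalueP => z zQ z0.
pose g x := \sum_i (if enum_val i == x then z 0 i else 0).
have gE j : g (enum_val j) = z 0 j.
  rewrite /g (bigD1 j) //= eqxx big1 ?addr0 // => i ij.
  by rewrite (inj_eq enum_val_inj) (negbTE ij).
have g_out x : x \notin verts H -> g x = 0.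
  move=> xV; apply: big1 => i _; case: eqP => // E.
  by rewrite -E enum_valP in xV.
have row_eq x : x \in verts H -> a * g x = \sum_(y | adj H x y) (g x + g y).
  move=> xV; rewrite -(enum_rankK_in xV xV); set j := enum_rank_in _ _.
  rewrite gE; have /matrixP/(_ 0 j) := zQ; rewrite [RHS]mxE => <-.
  rewrite mulmxDr mxE mul_mx_diag !mxE big_split /=; congr (_ + _).
    by rewrite sumr_const mulr_natr.
  transitivity (\sum_(y in verts H) g y * (adj H y (enum_val j))%:R).
    by rewrite [RHS]big_enum_val /=; apply: eq_bigr => i _; rewrite !mxE gE.
  rewrite [RHS]big_mkcond /= [LHS]big_mkcond /=; apply: eq_bigr => y _.
  rewrite adj_sym; case: ifP => [_|/negbT/g_out ->].
    by case: (adj H _ _); rewrite ?mulr1 ?mulr0.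
  by rewrite if_same.
have sum_eq : a * \sum_x g x ^+ 2 = \sum_x \sum_(y | adj H x y) (g x ^+ 2 + g x * g y).
  rewrite mulr_sumr; apply: eq_bigr => x _.
  have [xV|xV] := boolP (x \in verts H).
    rewrite expr2 mulrCA row_eq // mulr_sumr; apply: eq_bigr => y _; ring.
  rewrite g_out // expr0n /= mulr0 big1 // => y _; ring.
exists (fun x => `|g x|); split.
- by move=> x; apply: normr_ge0.
- by move=> x xV; rewrite g_out ?normr0.
- have /rV0Pn[j zj] := z0.
  rewrite (bigD1 (enum_val j)) //= ltr_pwDl //; last by apply: sumr_ge0 => *; apply: sqr_ge0.
  by rewrite gE exprn_gt0 // normr_gt0.
rewrite (eq_bigr (fun x => g x ^+ 2)); last by move=> x _; rewrite real_normK ?num_real.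
rewrite sum_eq; apply: ler_sum => x _; apply: ler_sum => y _.
by rewrite real_normK ?num_real // lerD2l -normrM ler_norm.
Qed.

End Quadratic.

(** If [H] lacks only vertices, an edge of [G] at a lacking vertex is lacking too. *)
Lemma missing_edge (T : finType) (G H : sgraph T) :
  (forall x, x \in verts G -> (0 < degree G x)%N) -> proper_subgraph H G ->
  exists u v, adj G u v /\ ~~ adj H u v.
Proof.
move=> deg [_ [HV HE] HG].
have [VV|] := boolP (verts G \subset verts H).
  have [/existsP[u /existsP[v /andP[? ?]]]|no] :=
    boolP [exists u, [exists v, adj G u v && ~~ adj H u v]].
    by exists u, v.
  case: HG; split; first by apply/eqP; rewrite eqEsubset HV VV.
  move=> x y; apply/idP/idP; first exact: HE.
  move=> xy; apply/negPn/negP => nxy; case/negP: no.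
  by apply/existsP; exists x; apply/existsP; exists y; rewrite xy.
case/subsetPn => u uG uH; have /card_gt0P[v uv] := deg u uG.
by exists u, v; split=> //; apply: contra uH => /adj_verts.
Qed.

Section FormBound.
Variables (R : realFieldType) (T : finType) (G H : sgraph T) (u v : T).
Variables (Delta : nat) (f : T -> R).
Hypotheses (G_reg : regular Delta G) (uv : adj G u v).
Hypotheses (HG : forall x y, adj H x y -> adj G x y) (nuv : ~~ adj H u v).
Hypotheses (f_ge0 : forall x, 0 <= f x)
  (f_out : forall x, x \notin verts G -> f x = 0).
Let h := del_edge (adj G) u v.

(** For [f >= 0] the form of [H] is at most that of [G - uv], because the latter has
    more edges, and [f x^2 + f x f y = 2 f x^2 - f x (f x - f y)] turns the form of
    [G - uv] into degrees minus energy; [u] and [v] have lost one degree each. *)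
Lemma form_le_deficit :
  \sum_x \sum_(y | adj H x y) (f x ^+ 2 + f x * f y)
   <= 2 * Delta%:R * (\sum_x f x ^+ 2)
      - (energy h f + 2 * f u ^+ 2 + 2 * f v ^+ 2).
Proof.
have uvN := adj_neq uv; have vu : adj G v u by rewrite adj_sym.
have hE : h =2 del_edge (adj G) v u.
  by move=> x y; rewrite /h /del_edge; congr (_ && _); rewrite andbC.
apply: (@le_trans _ _ (\sum_x \sum_(y | h x y) (f x ^+ 2 + f x * f y))).
  apply: ler_sum => x _; rewrite big_mkcond [leRHS]big_mkcond /=.
  apply: ler_sum => y _.
  have pos : 0 <= f x ^+ 2 + f x * f y by rewrite addr_ge0 ?sqr_ge0 ?mulr_ge0.
  case: ifP => [xy|_]; last by case: ifP.
  suff -> : h x y by [].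
  rewrite /h /del_edge HG //=.
  by apply/andP; split; apply: contraTN xy => /andP[/eqP-> /eqP->] //; rewrite adj_sym.
rewrite -(energyE (del_edge_sym G u v)) -/h.
have -> : \sum_x \sum_(y | h x y) (f x ^+ 2 + f x * f y) =
   \sum_x (2 * #|nbrs h x|%:R * f x ^+ 2)
     - \sum_x \sum_(y | h x y) (f x ^+ 2 - f x * f y).
  rewrite -sumrB; apply: eq_bigr => x _.
  have -> : 2 * #|nbrs h x|%:R * f x ^+ 2 = \sum_(y | h x y) 2 * f x ^+ 2.
    rewrite (eq_bigl (mem (nbrs h x))) => [|y]; last by rewrite /= inE.
    by rewrite sumr_const -[RHS]mulr_natl; ring.
  by rewrite -sumrB; apply: eq_bigr => y _; ring.
suff -> : \sum_x (2 * #|nbrs h x|%:R * f x ^+ 2) =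
   2 * Delta%:R * (\sum_x f x ^+ 2) - 2 * f u ^+ 2 - 2 * f v ^+ 2 by lra.
have du : (#|nbrs h u|%:R : R) = Delta%:R - 1.
  by rewrite -(G_reg (adj_verts uv)) -(card_nbrs_del_edge_end uv) -addn1 natrD; lra.
have dv : (#|nbrs h v|%:R : R) = Delta%:R - 1.
  have -> : nbrs h v = nbrs (del_edge (adj G) v u) v.
    by apply/setP => y; rewrite !inE hE.
  by rewrite -(G_reg (adj_verts vu)) -(card_nbrs_del_edge_end vu) -addn1 natrD; lra.
rewrite (bigD1 u) // (bigD1 v) 1?eq_sym //= du dv.
rewrite [in RHS](bigD1 u) // [in RHS](bigD1 v) 1?eq_sym //=.
rewrite (eq_bigr (fun x => 2 * Delta%:R * f x ^+ 2)) => [|x /andP[xu xv]]; last first.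
  have [xV|xV] := boolP (x \in verts G); last by rewrite f_out // expr0n /= !mulr0.
  by rewrite (card_nbrs_del_edge G xu xv) G_reg.
by rewrite -mulr_sumr; ring.
Qed.

End FormBound.

(** The supremum of an empty set is [0]: this is where [0 <= c] enters. *)
Lemma sup_le_const (R : realType) (A : classical_sets.set R) (c : R) :
  0 <= c -> (forall a, A a -> a <= c) -> sup A <= c.
Proof.
move=> c0 Ac; have [A0|noA] := boolp.pselect (exists a, A a).
  exact: ge_sup.
by rewrite sup_out // => -[].
Qed.

(** * The spectral gap *)

Theorem theorem1p2 (R : realType) (T : finType) (G H : sgraph T)
    (k Delta n : nat) (k_ge2 : (2 <= k)%N) (G_kconn : k_connected k G)
    (G_reg : regular Delta G) (G_card : #|verts G| = n)
    (H_proper : proper_subgraph H G) :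
  2 * Delta%:R - signless_radius R H >
    2 * (k%:R - 1) ^+ 2 /
    (2 * (n%:R - Delta%:R) * (n%:R - Delta%:R + 2 * k%:R - 4)
     + (n%:R + 1) * (k%:R - 1) ^+ 2).
Proof.
have k_le_deg x : x \in verts G -> (k <= degree G x)%N.
  by move=> xV; apply: leq_trans G_kconn (connectivity_le_degree xV).
have [u [v [uv nuv]]] : exists u v, adj G u v /\ ~~ adj H u v.
  apply: missing_edge H_proper => x /k_le_deg; apply: leq_trans.
  exact: ltnW.
have [_ [HV HE] _] := H_proper.
have uV := adj_verts uv.
have kD : (k <= Delta)%N by rewrite -(G_reg u uV) k_le_deg.
have Dn : (Delta < n)%N by rewrite -G_card -(G_reg u uV) degree_lt_card.
have kR : 2 <= k%:R :> R by rewrite ler_nat.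
have kDR : k%:R <= Delta%:R :> R by rewrite ler_nat.
have DnR : Delta%:R + 1 <= n%:R :> R by rewrite natr1 ler_nat.
pose m : R := k%:R - 1; pose M : R := n%:R - Delta%:R + 2 * k%:R - 4.
(* The stated bound is the inverse of [C + M / m^2], hence smaller than [C^-1]. *)
pose C : R := (n%:R - Delta%:R - 1) * (M / m ^+ 2) + (n%:R + 1) / 2.
have m2 : 0 < m ^+ 2 by rewrite exprn_gt0 // /m; lra.
have b0 : 0 < M / m ^+ 2 by rewrite divr_gt0 // /M; lra.
have C1 : 1 < C.
  have : 0 <= (n%:R - Delta%:R - 1) * (M / m ^+ 2).
    by rewrite mulr_ge0 ?(ltW b0) //; lra.
  by rewrite /C; lra.
have bound a : eigenvalue (signless_laplacian R H) a -> a <= 2 * Delta%:R - C^-1.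
  case/eigenvalue_form => f [f0 f_out fpos fa].
  have f_outG x : x \notin verts G -> f x = 0.
    by move=> xV; apply: f_out; apply: contra xV; apply: (subsetP HV).
  have le1 := form_le_deficit G_reg uv HE nuv f0 f_outG.
  have le2 := weight_le_deficit k_ge2 G_kconn G_reg uv f0 f_outG.
  rewrite G_card -/m -/M -/C in le2.
  set E := energy _ _ + _ + _ in le1 le2.
  set s := \sum_x f x ^+ 2 in fa fpos le1 le2.
  have C_gt0 : 0 < C by lra.
  have sE : C^-1 * s <= E by rewrite ler_pdivrMl.
  rewrite -(ler_pM2r fpos) mulrBl; lra.
have radius_le : signless_radius R H <= 2 * Delta%:R - C^-1.
  apply: sup_le_const; last exact: bound.
  have : C^-1 <= 1 by rewrite invf_le1 ?(lt_trans ltr01 C1) ?ltW.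
  by lra.
have -> : 2 * (k%:R - 1) ^+ 2 / (2 * (n%:R - Delta%:R) * (n%:R - Delta%:R + 2 * k%:R - 4)
     + (n%:R + 1) * (k%:R - 1) ^+ 2) = (C + M / m ^+ 2)^-1.
  rewrite -/m -/M.
  have -> : 2 * (n%:R - Delta%:R) * M + (n%:R + 1) * m ^+ 2
      = 2 * m ^+ 2 * (C + M / m ^+ 2).
    by rewrite /C /m; field; apply: lt0r_neq0; lra.
  by rewrite invfM mulVKf // mulf_neq0 ?pnatr_eq0 // gt_eqF.
have : (C + M / m ^+ 2)^-1 < C^-1 by rewrite ltf_pV2 ?posrE; lra.
lra.
Qed.
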